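(* Let $G$ be a fixed graph without isolated vertices, consisting of $k\ge 2$ edges and $l\ge 3$ vertices, and let $W$ be the number of copies of $G$ in the Erdős–Rényi random graph on $n$ vertices with edge probability $p=p(n)\in(0,1)$. Then there are constants $c_1,c_2>0$ depending only on $l$ and $k$ such that for every $\varepsilon>0$ $$P\left(W-\mathbb E W\ge \varepsilon\,\mathbb E W\right)\le\exp\left(-\frac{c_1\,\varepsilon^2 n^{2l}p^{2k}}{n^{2l-2}p^{2k-1}(1-p)+c_2\,\varepsilon\, n^{2l-2}p^{1-k}(1-p)^{-1}}\right).$$
   Context: The $\binom n2$ pairs of vertices (edges of the complete graph $K_n$) are enumerated $e_1,\dots,e_{\binom n2}$, and $X_1,\dots,X_{\binom n2}$ are independent with $P(X_i=1)=1-P(X_i=0)=p$, where $X_i=1$ means that edge $e_i$ is present. The number of copies of $G$ is $$W=\sum_{1\le\kappa_1<\dots<\kappa_k\le\binom n2}1_{\{(e_{\kappa_1},\dots,e_{\kappa_k})\sim G\}}\prod_{i=1}^kX_{\kappa_i},$$ where $(e_{\kappa_1},\dots,e_{\kappa_k})\sim G$ means that the subgraph of $K_n$ formed by these edges is isomorphic to $G$.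
   Formalization: The formal theorem assumes n ≥ l: for 1 ≤ n < l there are no copies of G, so W = E W = 0, the probability is 1 while the right-hand side is less than 1, and the claim fails (for n = 0 the quotient is 0/0). *)

(* Defs.v *)
From HB Require Import structures.
From mathcomp Require Import all_boot all_order all_algebra.
From mathcomp Require Import all_classical all_reals all_analysis.
Set Implicit Arguments.
Unset Strict Implicit.
Unset Printing Implicit Defensive.
Import Order.TTheory GRing.Theory Num.Theory.
Import numFieldNormedType.Exports.

Local Open Scope ring_scope.

Record sgraph := SGraph {
  vertex :> finType;
  adj : rel vertex;
  adj_sym : symmetric adj;
  adj_irr : irreflexive adj }.

Definition edge_set (G : sgraph) : {set {set G}} :=
  [set [set uv.1; uv.2] | uv : G * G & adj uv.1 uv.2].

Definition no_isolated (G : sgraph) : Prop :=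
  forall u : G, exists v : G, adj u v.

Definition graph_iso (G H : sgraph) : Prop :=
  exists f : G -> H, bijective f /\ forall u v, adj (f u) (f v) = adj u v.

Definition Kn_edge (n : nat) := {a : {set 'I_n} | #|a| == 2%N}.

(* The subgraph of K_n formed by a set F of edges has as vertices only the
   endpoints of the edges in F, not all of 'I_n. *)
Section EdgeSubgraph.
Variables (n : nat) (F : {set Kn_edge n}).

Definition covered : {set 'I_n} := \bigcup_(a in F) val a.

Definition edge_vertex := {u : 'I_n | u \in covered}.

Definition edge_adj : rel edge_vertex :=
  fun u v => [exists a in F, val a == [set val u; val v]].

Lemma edge_adj_sym : symmetric edge_adj.
Proof. by move=> u v; rewrite /edge_adj finset.setUC. Qed.

Lemma edge_adj_irr : irreflexive edge_adj.
Proof.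
move=> u; apply/negbTE/existsPn => a; apply/negP => /andP[_ /eqP a_uu].
by have := valP a; rewrite /= a_uu finset.setUid cards1.
Qed.

Definition edge_subgraph : sgraph :=
  @SGraph edge_vertex edge_adj edge_adj_sym edge_adj_irr.

End EdgeSubgraph.

Definition independent_RVs d (T : measurableType d) (R : realType)
    (P : probability T R) (I : finType) (X : I -> {RV P >-> R}) : Prop :=
  forall (J : {set I}) (B : I -> set R),
    (forall i, i \in J -> measurable (B i)) ->
    P [set t | forall i, i \in J -> B i (X i t)]%classic =
    (\prod_(i in J) P [set t | B i (X i t)]%classic)%E.

Definition bernoulli_RV d (T : measurableType d) (R : realType)
    (P : probability T R) (p : R) (X : {RV P >-> R}) : Prop :=
  P [set t | X t = 1]%classic = p%:E /\ P [set t | X t = 0]%classic = (1 - p)%:E.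

(* An increasing sequence kappa_1 < ... < kappa_k of edge indices is encoded by
   the k-element set K of its terms. *)
Definition copies (R : realType) (T : Type) (G : sgraph) (n k : nat)
    (e : 'I_('C(n, 2)) -> Kn_edge n) (X : 'I_('C(n, 2)) -> T -> R) (t : T) : R :=
  \sum_(K : {set 'I_('C(n, 2))} |
        (#|K| == k) && `[< graph_iso (edge_subgraph (e @: K)) G >])
     \prod_(i in K) X i t.

(* Main.v *)
Require Import Defs.
From mathcomp Require Import all_boot all_order all_algebra.
From mathcomp Require Import all_classical all_reals all_analysis.
From mathcomp Require Import measurable_realfun.
From mathcomp Require Import ring lra zify.
Import Order.TTheory GRing.Theory Num.Theory.
Import numFieldNormedType.Exports.
Local Open Scope ring_scope.

(* Let N be the number of possible copies and M(mu) = E exp(mu W). Conditioning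
   on the presence of a copy K forces the edges of K to be present, so
   E[W exp(mu W)] is the sum over K of p^k E exp(mu W(S u K)), where S is the
   random edge set. If each edge lies in at most D copies and mu k D <= 1/2,
   then W(S u K) - W(S) is bounded by the number of copies that meet K in an
   absent edge, and the same forcing argument applied to these copies gives
   E[W exp(mu W)] <= (N p^k + C mu (1-p) N D p^(2k-1)) M(mu) as soon as
   n p^(k-1) >= 1, when the pairs of copies sharing one single edge dominate.
   By convexity log M(mu) <= mu E[W exp(mu W)] / M(mu), and Chernoff's bound
   with a suitable mu gives the claim, since D is of order n^(l-2) and N of
   order n^l.
   If n p^(k-1) < 1 the exponent is at most eps p^k / 2, and Markov's inequality
   is enough when eps p^k <= 1; otherwise (1 + eps) E W > N and the event is
   empty. *)

(** * Averages over random subsets of a finite set *)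

Section Cube.
Context {R : realType} {I : finType}.
Implicit Types (p : R) (i : I) (S K : {set I}) (f g : {set I} -> R).

(** The probability of [S] under the product Bernoulli law on subsets of [I]. With [cube_mean] as
    expectation, all estimates become finite sums, and measure theory enters only when the law of
    the edge set is identified. *)
Definition cube_weight p S : R := \prod_i (if i \in S then p else 1 - p).

Definition cube_mean p f : R := \sum_S cube_weight p S * f S.

Lemma eq_cube_mean p f g : f =1 g -> cube_mean p f = cube_mean p g.
Proof. by move=> fg; apply: eq_bigr => S _; rewrite fg. Qed.

Lemma cube_weight_ge0 p S : 0 <= p <= 1 -> 0 <= cube_weight p S.
Proof.
move=> /andP[p0 p1]; apply: prodr_ge0 => i _.
by case: ifP => // _; rewrite subr_ge0.
Qed.

Lemma cube_mean_le p f g : 0 <= p <= 1 -> (forall S, f S <= g S) ->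
  cube_mean p f <= cube_mean p g.
Proof.
by move=> p01 fg; apply: ler_sum => S _; rewrite ler_wpM2l ?cube_weight_ge0.
Qed.

Lemma cube_meanD p f g :
  cube_mean p (fun S => f S + g S) = cube_mean p f + cube_mean p g.
Proof. by rewrite -big_split; apply: eq_bigr => S _; rewrite mulrDr. Qed.

Lemma cube_meanZ p (a : R) f :
  cube_mean p (fun S => a * f S) = a * cube_mean p f.
Proof. by rewrite mulr_sumr; apply: eq_bigr => S _; rewrite mulrCA. Qed.

Lemma cube_mean_sum (J : finType) (A : pred J) p (f : J -> {set I} -> R) :
  cube_mean p (fun S => \sum_(j | A j) f j S) =
  \sum_(j | A j) cube_mean p (f j).
Proof. by rewrite exchange_big; apply: eq_bigr => S _; rewrite mulr_sumr. Qed.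

Lemma cube_mean1 p : cube_mean p (fun=> 1) = 1.
Proof.
rewrite /cube_mean (eq_bigr (cube_weight p)) => [|S _]; last by rewrite mulr1.
have E := @bigA_distr R 0 1 *%R +%R I (fun=> p) (fun=> 1 - p).
by rewrite -E big1 // => i _ /=; rewrite addrC subrK.
Qed.

Lemma sum_sets_split i f :
  \sum_S f S = \sum_(S : {set I} | i \notin S) (f S + f (i |: S)).
Proof.
rewrite (bigID (fun S : {set I} => i \in S)) /= addrC big_split /=; congr (_ + _).
rewrite (reindex_onto (fun S => i |: S) (fun S => S :\ i)) /=; last first.
  by move=> S iS; rewrite finset.setD1K.
apply: eq_bigl => S; rewrite finset.setU11 /=.
apply/eqP/idP => [<-|iS]; first by rewrite finset.setD11.
by rewrite finset.setU1K.
Qed.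

Lemma cube_mean_cond p i f :
  cube_mean p f = p * cube_mean p (fun S => f (i |: S)) +
                  (1 - p) * cube_mean p (fun S => f (S :\ i)).
Proof.
(* [w] is the weight of the coordinates other than [i]; adding or removing [i] leaves it
   unchanged. *)
pose w S : R := \prod_(j | j != i) (if j \in S then p else 1 - p).
have wN S : i \notin S -> cube_weight p S = (1 - p) * w S.
  by move=> iS; rewrite /cube_weight (bigD1 i) //= (negbTE iS).
have wI S : cube_weight p (i |: S) = p * w S.
  rewrite /cube_weight (bigD1 i) //= finset.setU11; congr (_ * _).
  by apply: eq_bigr => j ji; rewrite finset.in_setU1 (negbTE ji).
rewrite /cube_mean !(sum_sets_split i) !mulr_sumr -big_split /=.
apply: eq_bigr => S iS; rewrite wN // wI finset.setUA finset.setUid finset.setU1K //.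
have -> : S :\ i = S by apply/finset.setDidPl; rewrite disjoint_sym disjoints1.
ring.
Qed.

Lemma cube_mean_in p i f :
  cube_mean p (fun S => (i \in S)%:R * f S) =
  p * cube_mean p (fun S => f (i |: S)).
Proof.
rewrite (cube_mean_cond p i) [X in _ + _ * X](_ : _ = 0) ?mulr0 ?addr0.
  by congr (_ * _); apply: eq_cube_mean => S; rewrite finset.setU11 mul1r.
by rewrite /cube_mean big1 // => S _; rewrite finset.setD11 mul0r mulr0.
Qed.

Lemma cube_mean_notin p i f :
  cube_mean p (fun S => (i \notin S)%:R * f S) =
  (1 - p) * cube_mean p (fun S => f (S :\ i)).
Proof.
rewrite (cube_mean_cond p i) [X in _ * X + _](_ : _ = 0) ?mulr0 ?add0r.
  by congr (_ * _); apply: eq_cube_mean => S; rewrite finset.setD11 mul1r.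
by rewrite /cube_mean big1 // => S _; rewrite finset.setU11 mul0r mulr0.
Qed.

(** The forcing identity: given that [K] is present, the random set is distributed as [K :|: S] with
    [S] unconditioned. The elements of [K] are forced one at a time. *)
Lemma cube_mean_subset p K f :
  cube_mean p (fun S => (K \subset S)%:R * f S) =
  p ^+ #|K| * cube_mean p (fun S => f (K :|: S)).
Proof.
have [m Km] := ubnP #|K|; elim: m K f Km => // m IH K f; rewrite ltnS => Km.
have [->|[i iK]] := set_0Vmem K.
  rewrite cards0 expr0 mul1r; apply: eq_cube_mean => S.
  by rewrite finset.sub0set mul1r finset.set0U.
rewrite (cardsD1 i K) iK exprS -mulrA.
rewrite (eq_cube_mean _ _ (fun S => (i \in S)%:R * ((K :\ i \subset S)%:R * f S))).
  rewrite cube_mean_in; congr (_ * _).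
  rewrite -(eq_cube_mean p (fun S => (K :\ i \subset S)%:R * f (i |: S))).
    rewrite IH; last by apply: leq_trans Km; rewrite [X in (_ < X)%N](cardsD1 i K) iK.
    congr (_ * _); apply: eq_cube_mean => S.
    by rewrite finset.setUA finset.setD1K.
  move=> S; congr (_%:R * _); rewrite -finset.subDset; congr (nat_of_bool _).
  by rewrite finset.setDDl finset.setUid.
move=> S; rewrite mulrA -natrM mulnb -finset.sub1set -finset.subUset.
by rewrite finset.setD1K.
Qed.

End Cube.

(** * The moment generating function of a subset count *)

(** From exp(-x) >= 1 - x one gets exp(x) <= 1/(1 - x), and (1 - x)(1 + 2x) = 1 + x(1 - 2x) >= 1 on
    this range. *)
Lemma expR_le1D2x {R : realType} (x : R) :
  0 <= x -> x <= 2^-1 -> expR x <= 1 + 2 * x.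
Proof.
move=> x0 x1; have := expR_ge1Dx (- x); rewrite expRN => h.
have e0 := expR_gt0 x.
have h1 : (1 - x) * expR x <= 1.
  by rewrite -[leRHS](mulVf (lt0r_neq0 e0)) ler_wpM2r // ltW.
have h2 : 0 <= x * (1 - 2 * x) by rewrite mulr_ge0 //; lra.
have h3 : 0 < 1 - x by lra.
rewrite -(ler_pM2l h3); apply: le_trans h1 _; lra.
Qed.

Section Count.
Context {R : realType} {I : finType}.
Variables (Fam : {set {set I}}) (p D D2 : R) (k : nat).
Hypothesis p01 : 0 <= p <= 1.
Hypothesis Fam_card : forall K, K \in Fam -> #|K| = k.
Hypothesis Fam_edge :
  forall i, (#|[set K in Fam | i \in K]|%:R : R) <= D.
Hypothesis D_ge0 : 0 <= D.
Hypothesis D2_ge0 : 0 <= D2.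
Hypothesis Fam_pair : forall i j, i != j ->
  (#|[set K in Fam | (i \in K) && (j \in K)]|%:R : R) <= D2.

Definition subset_count (S : {set I}) : R := \sum_(K in Fam) (K \subset S)%:R.

Local Notation W := subset_count.
Implicit Types (i j : I) (S K : {set I}).

Lemma subset_count_ge0 S : 0 <= W S.
Proof. exact: sumr_ge0. Qed.

Lemma subset_count_le S : W S <= #|Fam|%:R.
Proof.
rewrite -[leRHS]sumr_const; apply: ler_sum => K _ /=.
by rewrite lern1 leq_b1.
Qed.

Lemma subset_count_mono (S S' : {set I}) : S \subset S' -> W S <= W S'.
Proof.
move=> SS'; apply: ler_sum => K _; rewrite ler_nat.
by case: (boolP (K \subset S)) => // KS; rewrite (fintype.subset_trans KS SS').
Qed.

(** A member inside [K :|: S] but not inside [S] has an element outside [S], which must lie in [K];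
    the member is charged to that element. Keeping the indicator of [i \notin S] is what later
    produces the factor 1 - p. *)
Lemma subset_count_setU_diff K S :
  W (K :|: S) - W S <= \sum_(i in K) \sum_(K' in Fam | i \in K')
     (i \notin S)%:R * (K' \subset K :|: S)%:R.
Proof.
rewrite (eq_bigr (fun i => \sum_(K1 in Fam)
  (i \in K1)%:R * ((i \notin S)%:R * (K1 \subset K :|: S)%:R))) /=.
  rewrite exchange_big /= /subset_count -sumrB; apply: ler_sum => K' K'F.
  have [K'KS|_] := boolP (K' \subset K :|: S); last first.
    by rewrite (le_trans (y := 0)) ?sub0r ?oppr_le0 ?sumr_ge0 // => i _; rewrite !mulr_ge0.
  have [_|/subsetPn[i iK' iS]] := boolP (K' \subset S).
    by rewrite subrr sumr_ge0 // => i _; rewrite !mulr_ge0.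
  have iK : i \in K.
    by have := fintype.subsetP K'KS i iK'; rewrite finset.in_setU (negbTE iS) orbF.
  rewrite subr0 (bigD1 i) //= iK' iS !mul1r lerDl.
  by apply: sumr_ge0 => j _; rewrite !mulr_ge0.
move=> i _; rewrite big_mkcondr; apply: eq_bigr => K' _.
by case: (i \in K'); rewrite ?mul1r ?mul0r.
Qed.

Lemma subset_count_setU_le K S : W (K :|: S) - W S <= #|K|%:R * D.
Proof.
apply: le_trans (subset_count_setU_diff K S) _.
rewrite mulr_natl -sumr_const; apply: ler_sum => i _.
apply: le_trans (Fam_edge i); rewrite -sum1_card natr_sum.
rewrite [leRHS](eq_bigl (fun K1 => (K1 \in Fam) && (i \in K1))); last first.
  by move=> K1; rewrite !finset.inE.
by apply: ler_sum => K' _; rewrite -natrM mulnb lern1 leq_b1.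
Qed.

(** At most [D] members meet [K] in [i] alone, and each contributes p^(k-1). Any other member shares
    a second element [j] of [K]; it contributes at most 1, and there are at most [D2] of them for
    each [j]. *)
Lemma sum_overlap_le i K : i \in K -> K \in Fam ->
  \sum_(K' in Fam | i \in K') p ^+ #|K' :\: K| <= D * p ^+ k.-1 + k%:R * D2.
Proof.
move=> iK KF; case/andP: p01 => p0 p1.
pose b K' : R := p ^+ k.-1 + \sum_(j in K :\ i) (j \in K')%:R.
apply: (@le_trans _ _ (\sum_(K' in Fam | i \in K') b K')).
  apply: ler_sum => K' /andP[K'F iK'].
  have [/exists_inP[j jK jK']|/existsPn dj] :=
      boolP [exists j in K :\ i, j \in K'].
    rewrite /b (bigD1 j) //= jK'.
    have := exprn_ge0 k.-1 p0; have := exprn_ile1 #|K' :\: K| p0 p1.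
    have : 0 <= \sum_(l in K :\ i | l != j) (l \in K')%:R :> R by apply: sumr_ge0.
    by rewrite /=; lra.
  have -> : K' :\: K = K' :\ i.
    apply/setP => j; rewrite !finset.inE; case: (boolP (j \in K')) => jK';
      rewrite ?andbF ?andbT //.
    have := dj j; rewrite !finset.inE jK' andbT negb_and negbK.
    by case: (eqVneq j i) => [->|_] /=; [rewrite iK|].
  have -> : #|K' :\ i| = k.-1 by rewrite -(Fam_card _ K'F) (cardsD1 i K') iK'.
  by rewrite lerDl sumr_ge0.
rewrite big_split /= exchange_big /=; apply: lerD.
  rewrite sumr_const -[leLHS]mulr_natl ler_wpM2r ?exprn_ge0 //.
  apply: le_trans (Fam_edge i); rewrite ler_nat.
  by apply/eq_leq/eq_card => K'; rewrite !finset.inE.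
apply: (@le_trans _ _ (\sum_(j in K :\ i) D2)); last first.
  rewrite sumr_const -[leLHS]mulr_natl ler_wpM2r // ler_nat -(Fam_card _ KF).
  by rewrite subset_leq_card ?finset.subsetDl.
apply: ler_sum => j; rewrite !finset.inE => /andP[ji jK].
rewrite eq_sym in ji; apply: le_trans (Fam_pair _ _ ji).
rewrite -sum1_card natr_sum big_mkcond [leRHS]big_mkcond; apply: ler_sum => K' _.
by rewrite !finset.inE; case: (K' \in Fam) => //=; case: (i \in K'); case: (j \in K').
Qed.

Definition mgf (mu : R) : R := cube_mean p (fun S => expR (mu * W S)).

Section Tilt.
Variable mu : R.
Hypothesis mu_ge0 : 0 <= mu.
Hypothesis muD : mu * (k%:R * D) <= 2^-1.

Lemma mgf_ge1 : 1 <= mgf mu.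
Proof.
rewrite -(cube_mean1 (I := I) p); apply: cube_mean_le => // S.
by rewrite -expR0 ler_expR mulr_ge0 ?subset_count_ge0.
Qed.

Lemma subset_count_shift K S : (#|K| <= k)%N ->
  0 <= mu * (W (K :|: S) - W S) <= 2^-1.
Proof.
move=> Kk; apply/andP; split.
  by rewrite mulr_ge0 // subr_ge0 subset_count_mono // finset.subsetUr.
apply: le_trans muD; rewrite ler_wpM2l //.
by apply: le_trans (subset_count_setU_le K S) _; rewrite ler_wpM2r // ler_nat.
Qed.

Lemma expR_count_setU K S :
  expR (mu * W (K :|: S)) = expR (mu * W S) * expR (mu * (W (K :|: S) - W S)).
Proof. by rewrite -expRD; congr expR; ring. Qed.

(** A crude bound, sufficient inside terms that already carry a factor mu: the exponent grows by at
    most 1/2, so the exponential at most doubles. *)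
Lemma tilted_shift_le K : (#|K| <= k)%N ->
  cube_mean p (fun S => expR (mu * W (K :|: S))) <= 2 * mgf mu.
Proof.
move=> Kk; rewrite -cube_meanZ; apply: cube_mean_le => // S.
rewrite expR_count_setU mulrC ler_wpM2r ?expR_ge0 //.
have /andP[d0 d1] := subset_count_shift _ S Kk.
by apply: le_trans (expR_le1D2x _ d0 d1) _; lra.
Qed.

(** Absence of [i] costs 1 - p and replaces [S] by [S :\ i]. The remaining factors are at most
    increasing functions of [S], so [i] may be put back; forcing [K' :\: K] then gives the power of
    p, and the crude shift bound the 2. *)
Lemma tilted_overlap_le i K K' : (#|K' :\: K| <= k)%N ->
  cube_mean p (fun S => ((i \notin S)%:R * (K' \subset K :|: S)%:R) *
                        expR (mu * W S)) <=
  2 * (1 - p) * p ^+ #|K' :\: K| * mgf mu.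
Proof.
move=> Kk; case/andP: (p01) => p0 p1.
under eq_cube_mean do rewrite -mulrA.
rewrite (cube_mean_notin p i
  (fun S => (K' \subset K :|: S)%:R * expR (mu * W S))).
rewrite (mulrC 2) -!mulrA ler_wpM2l ?subr_ge0 //.
apply: (@le_trans _ _ (cube_mean p (fun S =>
    (K' :\: K \subset S)%:R * expR (mu * W S)))).
  apply: cube_mean_le => // S; rewrite -finset.subDset.
  case: (boolP (_ \subset S :\ i)) => [h|_]; last by rewrite mul0r mulr_ge0 ?expR_ge0.
  rewrite (fintype.subset_trans h) ?finset.subsetDl // !mul1r ler_expR ler_wpM2l //.
  by rewrite subset_count_mono ?finset.subsetDl.
rewrite (cube_mean_subset p (K' :\: K) (fun S => expR (mu * W S))).
by rewrite mulrCA ler_wpM2l ?exprn_ge0 // tilted_shift_le.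
Qed.

(** With d the increase of mu W caused by adding [K], exp(d) <= 1 + 2d; d is bounded by the charged
    members and each is averaged by [tilted_overlap_le]. The 4 is the product of the two factors 2,
    and k counts the elements of [K] that are charged. *)
Lemma mgf_shift_le K : K \in Fam ->
  cube_mean p (fun S => expR (mu * W (K :|: S))) <=
  (1 + 4 * mu * (1 - p) * k%:R * (D * p ^+ k.-1 + k%:R * D2)) * mgf mu.
Proof.
move=> KF; case/andP: (p01) => p0 p1.
have Kk := Fam_card _ KF.
pose T i K' S : R := (i \notin S)%:R * (K' \subset K :|: S)%:R.
apply: (@le_trans _ _ (cube_mean p (fun S => expR (mu * W S) +
    2 * mu * \sum_(i in K) \sum_(K' in Fam | i \in K') T i K' S * expR (mu * W S)))).
  apply: cube_mean_le => // S; rewrite expR_count_setU.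
  have /andP[d0 d1] : 0 <= mu * (W (K :|: S) - W S) <= 2^-1.
    by apply: subset_count_shift; rewrite Kk.
  under eq_bigr do rewrite -mulr_suml.
  rewrite -mulr_suml mulrA -[X in _ <= X + _]mul1r -mulrDl mulrC.
  rewrite ler_wpM2r ?expR_ge0 //; apply: le_trans (expR_le1D2x _ d0 d1) _.
  by rewrite lerD2l -mulrA ler_wpM2l // ler_wpM2l // subset_count_setU_diff.
rewrite cube_meanD -/(mgf mu) [leRHS]mulrDl mul1r lerD2l cube_meanZ cube_mean_sum.
rewrite (_ : 4 * mu * _ * _ * _ * _ =
  2 * mu * (k%:R * ((D * p ^+ k.-1 + k%:R * D2) * (2 * (1 - p) * mgf mu))));
  last by ring.
rewrite ler_wpM2l ?mulr_ge0 //.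
rewrite -[in leRHS]Kk [leRHS]mulr_natl -sumr_const; apply: ler_sum => i iK.
rewrite cube_mean_sum.
apply: (@le_trans _ _ (\sum_(K' in Fam | i \in K')
    p ^+ #|K' :\: K| * (2 * (1 - p) * mgf mu))).
  apply: ler_sum => K' /andP[K'F iK'].
  apply: le_trans (tilted_overlap_le i K K' _) _.
    by rewrite -(Fam_card _ K'F) subset_leq_card ?finset.subsetDl.
  by rewrite le_eqVlt; apply/orP; left; apply/eqP; ring.
rewrite -mulr_suml Kk ler_wpM2r ?sum_overlap_le //.
by rewrite !mulr_ge0 ?subr_ge0 // (le_trans ler01) ?mgf_ge1.
Qed.

Lemma tilted_mean_le :
  cube_mean p (fun S => W S * expR (mu * W S)) <=
  #|Fam|%:R * p ^+ k *
  (1 + 4 * mu * (1 - p) * k%:R * (D * p ^+ k.-1 + k%:R * D2)) * mgf mu.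
Proof.
case/andP: (p01) => p0 p1.
under eq_cube_mean do rewrite mulr_suml.
rewrite cube_mean_sum -!mulrA [leRHS]mulr_natl -sumr_const.
apply: ler_sum => K KF.
rewrite (cube_mean_subset p K (fun S => expR (mu * W S))) (Fam_card _ KF).
by rewrite ler_wpM2l ?exprn_ge0 // !mulrA mgf_shift_le.
Qed.

(* Convexity of the log-moment generating function [log (mgf mu)]: it is at
   most [mu] times its derivative at [mu], the mean of [W] under the tilted
   law. *)
Lemma mgf_le :
  mgf mu <= expR (mu * (#|Fam|%:R * p ^+ k *
     (1 + 4 * mu * (1 - p) * k%:R * (D * p ^+ k.-1 + k%:R * D2)))).
Proof.
have M0 : 0 < mgf mu by apply: lt_le_trans ltr01 mgf_ge1.
pose a := cube_mean p (fun S => W S * expR (mu * W S)) / mgf mu.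
have aM : a * mgf mu = cube_mean p (fun S => W S * expR (mu * W S)).
  by rewrite divfK ?lt0r_neq0.
apply: (@le_trans _ _ (expR (mu * a))); last first.
  by rewrite ler_expR ler_wpM2l // ler_pdivrMr // tilted_mean_le.
have e0 := expR_gt0 (- (mu * a)).
rewrite -(ler_pM2l e0) -expRD addNr expR0 -(cube_mean1 (I := I) p).
(* Jensen's inequality by a tangent line. A multiple of (W - a) exp(mu W) is subtracted, which has
   mean zero by the choice of [a]; with y = mu (W - a) the integrand becomes exp(y)(1 - y), which is
   at most 1 pointwise. *)
apply: (@le_trans _ _ (cube_mean p (fun S => expR (- (mu * a)) * (1 + mu * a) *
    expR (mu * W S) + - (expR (- (mu * a)) * mu) * (W S * expR (mu * W S))))).
  rewrite cube_meanD !cube_meanZ -/(mgf mu) -aM le_eqVlt; apply/orP; left.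
  by apply/eqP; ring.
apply: cube_mean_le => // S.
have := expR_ge1Dx (- (mu * (W S - a))) => h.
have -> : expR (- (mu * a)) * (1 + mu * a) * expR (mu * W S) +
    - (expR (- (mu * a)) * mu) * (W S * expR (mu * W S)) =
    expR (- (mu * a)) * expR (mu * W S) * (1 - mu * (W S - a)) by ring.
have e1 : expR (- (mu * a)) * expR (mu * W S) * expR (- (mu * (W S - a))) = 1.
  by rewrite -!expRD -expR0; congr expR; ring.
by rewrite -[leRHS]e1 ler_wpM2l ?mulr_ge0 ?expR_ge0.
Qed.

End Tilt.
End Count.

(** * Upper tail of a subset count *)

Section Tail.
Context {R : realType} {I : finType}.
Variables (Fam : {set {set I}}) (p D D2 : R) (k : nat).
Hypothesis p0 : 0 < p.
Hypothesis p1 : p < 1.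
Hypothesis k_gt0 : (0 < k)%N.
Hypothesis Fam_card : forall K, K \in Fam -> #|K| = k.
Hypothesis Fam_edge :
  forall i, (#|[set K in Fam | i \in K]|%:R : R) <= D.
Hypothesis D_gt0 : 0 < D.
Hypothesis D2_ge0 : 0 <= D2.
Hypothesis Fam_pair : forall i j, i != j ->
  (#|[set K in Fam | (i \in K) && (j \in K)]|%:R : R) <= D2.

Local Notation W := (@subset_count R I Fam).
Local Notation N := (#|Fam|%:R : R).
Local Notation Pr A := (cube_mean p (fun S => (A S)%:R)).

Let p01 : 0 <= p <= 1. Proof. by rewrite !ltW. Qed.
Let D_ge0 : 0 <= D. Proof. exact: ltW. Qed.

Lemma chernoff_count (mu a : R) : 0 <= mu ->
  Pr (fun S => a <= W S) <= expR (- (mu * a)) * mgf Fam p mu.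
Proof.
move=> mu0; rewrite -cube_meanZ; apply: cube_mean_le => // S.
case: (leP a (W S)) => [aW|_]; last by rewrite mulr_ge0 ?expR_ge0.
rewrite -expRD -[X in X <= _]expR0 ler_expR addrC subr_ge0.
by rewrite ler_wpM2l.
Qed.

Lemma cube_mean_count : cube_mean p W = N * p ^+ k.
Proof.
rewrite /subset_count cube_mean_sum mulr_natl -sumr_const.
apply: eq_bigr => K KF; have := @cube_mean_subset R I p K (fun=> 1).
rewrite cube_mean1 mulr1 (Fam_card _ KF) => <-.
by apply: eq_cube_mean => S; rewrite mulr1.
Qed.

Lemma markov_count (a : R) : 0 < a -> Pr (fun S => a <= W S) <= N * p ^+ k / a.
Proof.
move=> a0; rewrite ler_pdivlMr // mulrC -cube_meanZ -cube_mean_count.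
apply: cube_mean_le => // S.
case: (leP a (W S)) => [aW|_]; first by rewrite mulr1.
by rewrite mulr0 subset_count_ge0.
Qed.

Lemma prob_count_gt_card (a : R) : N < a -> Pr (fun S => a <= W S) = 0.
Proof.
move=> Na; rewrite /cube_mean big1 // => S _.
by rewrite leNgt (le_lt_trans (subset_count_le Fam S) Na) mulr0.
Qed.

Lemma count_tail_chernoff (r eps A den : R) : 0 <= r -> 0 < eps ->
  D2 <= r * (D * p ^+ k.-1) ->
  A = 4 * k%:R * (1 + k%:R * r) ->
  den = p ^+ k * p ^+ k.-1 * (1 - p) + eps / (p ^+ k.-1 * (1 - p)) ->
  Pr (fun S => (1 + eps) * (N * p ^+ k) <= W S) <=
  expR (- (N / D * (eps ^+ 2 * (p ^+ k) ^+ 2 / (4 * A * den)))).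
Proof.
move=> r0 e0 D2r AE denE.
set u := p ^+ k; set v := p ^+ k.-1; set q := 1 - p.
have u0 : 0 < u by rewrite exprn_gt0.
have v0 : 0 < v by rewrite exprn_gt0.
have u1 : u <= 1 by rewrite exprn_ile1 ?ltW.
have v1 : v <= 1 by rewrite exprn_ile1 ?ltW.
have q0 : 0 < q by rewrite subr_gt0.
have q1 : q <= 1 by rewrite lerBlDr lerDl ltW.
have k1 : 1 <= k%:R :> R by rewrite ler1n.
have A_ge : k%:R <= A.
  rewrite AE; have : 0 <= k%:R * r by rewrite mulr_ge0.
  by move=> h; nra.
have A0 : 0 < A by lra.
have den1 : u * v * q < den.
  by rewrite denE -/u -/v -/q ltrDl divr_gt0 ?mulr_gt0.
have den2 : eps <= den * (v * q).
  rewrite denE -/u -/v -/q mulrDl divfK ?lt0r_neq0 ?mulr_gt0 //.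
  by rewrite lerDr !mulr_ge0 ?ltW.
have den0 : 0 < den by apply: lt_trans den1; rewrite !mulr_gt0.
(* The Chernoff parameter is mu = nu / D. The second summand of [den] ensures mu k D <= 1/2 ([nu1]),
   so that [mgf_le] applies; the first keeps the correction term below eps / 2 ([nu2]), so half of
   the linear gain mu N u eps survives. *)
pose nu := eps * u / (2 * A * den).
have nu0 : 0 < nu by rewrite divr_gt0 ?mulr_gt0.
have nu1 : nu * k%:R <= 2^-1.
  rewrite /nu mulrAC ler_pdivrMr ?mulr_gt0 //.
  rewrite (_ : 2^-1 * _ = A * den); last by field.
  apply: (@le_trans _ _ (den * (v * q) * 1 * A)).
    apply: ler_pM => //; first by rewrite mulr_ge0 ?ltW.
    by apply: ler_pM => //; rewrite ltW.
  rewrite mulr1 mulrC; apply/ler_wpM2l; first exact: ltW.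
  rewrite -[leRHS]mulr1; apply/ler_wpM2l; first exact: ltW.
  by apply: mulr_ile1 => //; apply: ltW.
have nu2 : A * nu * q * v <= eps / 2.
  rewrite (_ : _ * v = eps / 2 * (u * v * q / den)); last first.
    by rewrite /nu; field; rewrite !lt0r_neq0.
  rewrite -[leRHS]mulr1; apply/ler_wpM2l; first by rewrite divr_ge0 ?ltW.
  by rewrite ler_pdivrMr // mul1r ltW.
have mu0 : 0 <= nu / D by rewrite divr_ge0 ?ltW.
apply: le_trans (chernoff_count _ _ mu0) _.
have mk : nu / D * (k%:R * D) <= 2^-1.
  by rewrite (mulrC k%:R) mulrA divfK ?lt0r_neq0.
apply: le_trans (ler_wpM2l (expR_ge0 _) 
  (mgf_le Fam p D D2 k p01 Fam_card Fam_edge D_ge0 D2_ge0 Fam_pair _ mu0 mk)) _.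
rewrite -expRD ler_expR -/u -/v -/q.
have nu3 : 4 * (nu / D) * q * k%:R * (D * v + k%:R * D2) <= eps / 2.
  apply: le_trans nu2.
  rewrite (_ : A * nu * q * v =
      4 * (nu / D) * q * k%:R * (D * v + k%:R * (r * (D * v)))).
    apply/ler_wpM2l; first by rewrite mulr_ge0 // mulr_ge0 ?(ltW q0) // mulr_ge0.
    by rewrite lerD2l ler_wpM2l.
  by rewrite AE; field; rewrite lt0r_neq0.
have -> : N / D * (eps ^+ 2 * u ^+ 2 / (4 * A * den)) =
    nu / D * (N * u) * (eps / 2).
  by rewrite /nu; field; rewrite !lt0r_neq0.
rewrite [leLHS](_ : _ = nu / D * (N * u) *
    (4 * (nu / D) * q * k%:R * (D * v + k%:R * D2) - eps)); last by ring.
rewrite -mulrN; apply/ler_wpM2l; first by rewrite mulr_ge0 // mulr_ge0 // ltW.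
lra.
Qed.

(** The lower bound on [N] serves the Chernoff case: it says 4 c A n^2 D <= N with A = 4 k (1 + k
    r). The bound c <= 1/2 serves the Markov case. *)
Lemma count_tail (r eps n c : R) : 0 <= r -> 0 < eps -> 0 < n -> 0 < c ->
  (0 < #|Fam|)%N -> D2 <= r * D / n -> c <= 2^-1 ->
  c * (16 * k%:R * (1 + k%:R * r)) * n ^+ 2 * D <= N ->
  Pr (fun S => (1 + eps) * (N * p ^+ k) <= W S) <=
  expR (- (c * n ^+ 2 * eps ^+ 2 * (p ^+ k) ^+ 2 /
    (p ^+ k * p ^+ k.-1 * (1 - p) + eps / (p ^+ k.-1 * (1 - p))))).
Proof.
move=> r0 e0 n0 c0 F0 D2r c1 cN; set den := (X in _ / X).
have u0 : 0 < p ^+ k by rewrite exprn_gt0.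
have v0 : 0 < p ^+ k.-1 by rewrite exprn_gt0.
have q0 : 0 < 1 - p by rewrite subr_gt0.
have q1 : 1 - p <= 1 by rewrite lerBlDr lerDl ltW.
have k1 : 1 <= k%:R :> R by rewrite ler1n.
have N0 : 0 < N by rewrite ltr0n.
have den0 : 0 < den by rewrite addr_gt0 ?divr_gt0 ?mulr_gt0.
have [nv|nv] := leP 1 (n * p ^+ k.-1).
  have D2v : D2 <= r * (D * p ^+ k.-1).
    apply: le_trans D2r _; rewrite ler_pdivrMr // -mulrA ler_wpM2l //.
    rewrite -[leLHS]mulr1 -!mulrA; apply/ler_wpM2l; first exact: ltW.
    by rewrite mulrC.
  apply: le_trans (count_tail_chernoff r eps _ _ r0 e0 D2v erefl erefl) _.
  rewrite ler_expR lerN2 -/den.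
  set A := 4 * k%:R * (1 + _).
  have kr : 0 <= k%:R * r by rewrite mulr_ge0.
  have A0 : 0 < A by rewrite /A !mulr_gt0 //; lra.
  rewrite [leRHS](_ : _ = N / (4 * A * D) * (eps ^+ 2 * (p ^+ k) ^+ 2 / den)); last first.
    by field; rewrite !lt0r_neq0.
  rewrite (_ : c * _ * _ * _ / den =
    c * n ^+ 2 * (eps ^+ 2 * (p ^+ k) ^+ 2 / den)); last by rewrite -!mulrA.
  apply/ler_wpM2r; first by rewrite divr_ge0 ?mulr_ge0 ?sqr_ge0 ?ltW.
  rewrite ler_pdivlMr; last by rewrite mulr_gt0 // mulr_gt0.
  apply: le_trans _ cN.
  by rewrite le_eqVlt; apply/orP; left; apply/eqP; rewrite /A; ring.
have [eu|eu] := leP (eps * p ^+ k) 1; last first.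
  rewrite prob_count_gt_card ?expR_ge0 //.
  by rewrite mulrCA -[ltLHS]mulr1 ltr_pM2l // mulrDl mul1r ltr_wpDl ?ltW.
(* Markov's bound is 1 / (1 + eps), so it remains to see that exp(x) <= 1 + eps for the exponent
   [x]. *)
apply: le_trans (markov_count _ _) _; first by rewrite !mulr_gt0 ?addr_gt0.
rewrite invfM mulrCA divff ?lt0r_neq0 ?mulr_gt0 // mulr1.
rewrite expRN lef_pV2 ?posrE ?expR_gt0 ?addr_gt0 //.
set x := _ / den.
have x0 : 0 <= x by rewrite divr_ge0 ?mulr_ge0 ?sqr_ge0 ?ltW.
(* Only the second summand of [den] is used: p^k p^(k-1) = p (p^(k-1))^2, so n^2 p^k p^(k-1) (1 - p)
   = (n p^(k-1))^2 p (1 - p) <= 1. *)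
have xe : x <= c * (eps * p ^+ k).
  rewrite ler_pdivrMr //.
  rewrite (_ : c * _ * _ * _ = c * (eps * p ^+ k) * (n ^+ 2 * eps * p ^+ k)); last by ring.
  apply/ler_wpM2l; first by rewrite !mulr_ge0 ?ltW.
  apply: (@le_trans _ _ (eps / (p ^+ k.-1 * (1 - p)))); last first.
    by rewrite lerDr !mulr_ge0 ?ltW.
  rewrite ler_pdivlMr ?mulr_gt0 //.
  rewrite (_ : _ * (_ * (1 - p)) = eps * ((n * p ^+ k.-1) ^+ 2 * (p * (1 - p)))); last first.
    by have -> : p ^+ k = p * p ^+ k.-1; [rewrite -exprS prednK|ring].
  rewrite -[leRHS]mulr1; apply/ler_wpM2l; first exact: ltW.
  apply: mulr_ile1; rewrite ?sqr_ge0 ?mulr_ge0 ?ltW //.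
    by rewrite exprn_ilt1 // mulr_ge0 ?ltW.
  by rewrite mulr_ilt1 ?ltW // ltrBlDr ltrDl.
have x1 : x <= 2^-1 by apply: le_trans xe _; nra.
apply: le_trans (expR_le1D2x x x0 x1) _.
rewrite lerD2l; apply: (@le_trans _ _ (eps * p ^+ k)); first by nra.
rewrite -[leRHS]mulr1; apply/ler_wpM2l; first exact: ltW.
by rewrite exprn_ile1 ?ltW.
Qed.

End Tail.

(** * Counting copies in the complete graph *)

(** Removing [U] is injective on the supersets of [U] and lands in the subsets of its complement of
    size l - |U|. *)
Lemma card_supersets (T : finType) (U : {set T}) (l : nat) :
  (#|U| <= l)%N ->
  (#|[set A : {set T} | (U \subset A) && (#|A| == l)]| <=
   'C(#|T| - #|U|, l - #|U|))%N.
Proof.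
move=> Ul; have <- : #|~: U| = (#|T| - #|U|)%N by rewrite -(cardsC U) addKn.
rewrite -cards_draws -(card_in_imset (f := fun A => A :\: U)).
  apply/subset_leq_card/fintype.subsetP => B /imsetP[A].
  rewrite !finset.inE => /andP[UA /eqP Al] ->.
  rewrite finset.setDE finset.subsetIr /= -finset.setDE cardsD.
  by rewrite (finset.setIidPr UA) Al.
move=> A B; rewrite !finset.inE => /andP[UA _] /andP[UB _] E.
by rewrite -(finset.setID A U) -(finset.setID B U) E (finset.setIidPr UA) (finset.setIidPr UB).
Qed.

Section Copies.
Variables (n : nat) (G : sgraph) (k : nat) (e : 'I_('C(n, 2)) -> Kn_edge n).
Hypothesis e_bij : bijective e.
Implicit Types (K : {set 'I_('C(n, 2))}) (A U : {set 'I_n}).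

Definition copy_family : {set {set 'I_('C(n, 2))}} :=
  [set K : {set 'I_('C(n, 2))} |
    (#|K| == k) && `[< graph_iso (edge_subgraph (e @: K)) G >]].

Definition copy_vertices K : {set 'I_n} := covered (e @: K).

Lemma edge_sub_copy_vertices K i : i \in K -> val (e i) \subset copy_vertices K.
Proof. by move=> iK; apply: (finset.bigcup_sup (e i)); apply: imset_f. Qed.

Lemma card_copy_vertices K : K \in copy_family -> #|copy_vertices K| = #|G|.
Proof.
rewrite finset.inE => /andP[_ /asboolP[f [f_bij _]]].
by rewrite -(bij_eq_card f_bij) card_sig; apply: eq_card.
Qed.

(** Each edge of [K] is a subset of [A], and [K] is determined by its set of edges. Crude, but
    independent of n. *)
Lemma card_copies_within A :
  (#|[set K : {set 'I_('C(n, 2))} | copy_vertices K \subset A]| <= 2 ^ (2 ^ #|A|))%N.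
Proof.
rewrite -!card_powerset.
pose g K := [set val (e i) | i in K].
rewrite -(card_in_imset (f := g)); last first.
  move=> K K' _ _; apply: imset_inj => i j /val_inj.
  exact: (bij_inj e_bij).
apply/subset_leq_card/fintype.subsetP => B /imsetP[K]; rewrite finset.inE => KA ->.
rewrite powersetE; apply/fintype.subsetP => a /imsetP[i iK ->].
by rewrite powersetE (fintype.subset_trans (edge_sub_copy_vertices _ _ iK)).
Qed.

(** Copies are grouped by their vertex set, which has as many vertices as [G] and contains [U]; each
    such set carries boundedly many copies. *)
Lemma card_copies_through U : (#|U| <= #|G|)%N ->
  (#|[set K in copy_family | U \subset copy_vertices K]| <=
   2 ^ (2 ^ #|G|) * 'C(n - #|U|, #|G| - #|U|))%N.
Proof.
move: #|G| (fun K => @card_copy_vertices K) => l cardl Ul.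
pose Z := [set A : {set 'I_n} | (U \subset A) && (#|A| == l)].
rewrite -sum1_card (partition_big copy_vertices (fun A => A \in Z)) /=; last first.
  move=> K; rewrite finset.inE => /andP[KF UK].
  by rewrite finset.inE UK cardl /=.
apply: (@leq_trans (\sum_(A in Z) 2 ^ (2 ^ l))).
  apply: leq_sum => A; rewrite finset.inE => /andP[_ /eqP Al].
  rewrite -Al sum1_card; apply: leq_trans (card_copies_within A).
  apply/subset_leq_card/fintype.subsetP => K.
  by rewrite !finset.inE => /andP[_ /eqP ->].
rewrite sum_nat_const mulnC leq_mul2l.
by have := card_supersets _ U l Ul; rewrite card_ord => ->; rewrite orbT.
Qed.

Hypothesis G_edges : #|edge_set G| = k.
Hypothesis G_noiso : no_isolated G.

(** [G] is transported along a bijection [f] onto [A]. Since [G] has no isolated vertex, the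
    transported edges cover all of [A]. *)
Lemma copy_on A : #|A| = #|G| -> exists2 K, K \in copy_family & copy_vertices K = A.
Proof.
move=> AG; have [f f_inj fA] : exists2 f : G -> 'I_n, injective f & f @: G = A.
  exists (fun u => enum_val (cast_ord (esym AG) (enum_rank u))).
    by move=> u v /enum_val_inj /cast_ord_inj /enum_rank_inj.
  apply/setP => x; apply/imsetP/idP => [[u _ ->]|xA]; first exact: enum_valP.
  exists (enum_val (cast_ord AG (enum_rank_in xA x))) => //.
  by rewrite enum_valK cast_ordK enum_rankK_in.
have [e' eK e'K] := e_bij.
pose F : {set Kn_edge n} :=
  [set a | val a \in [set f @: (x : {set G}) | x in edge_set G]].
pose K := e' @: F.
have eF : e @: K = F.
  rewrite /K -imset_comp (eq_imset (g := id)) ?imset_id // => a /=.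
have edgeF u v : adj u v -> exists2 a, a \in F & val a = [set f u; f v].
  move=> uv; have fuv : f u != f v.
    by apply/eqP => /f_inj E; rewrite E adj_irr in uv.
  have c2 : #|[set f u; f v]| == 2%N by rewrite cards2 fuv.
  exists (exist (fun a : {set 'I_n} => #|a| == 2%N) _ c2) => //.
  rewrite finset.inE /=; apply/imsetP.
  exists [set u; v]; last by rewrite imsetU1 imset_set1.
  by apply/imsetP; exists (u, v); rewrite ?finset.inE.
have Fedge a : a \in F -> exists u v, adj u v /\ val a = [set f u; f v].
  rewrite finset.inE => /imsetP[x /imsetP[[u v]]]; rewrite finset.inE /= => uv -> ->.
  by exists u, v; rewrite imsetU1 imset_set1.
have covF : covered F = A.
  apply/setP => x; rewrite -fA; apply/bigcupP/imsetP => [[a aF]|[u _ ->]].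
    have [u [v [_ ->]]] := Fedge a aF; rewrite !finset.inE.
    by case/orP => /eqP ->; [exists u | exists v].
  have [v uv] := G_noiso u; have [a aF aE] := edgeF u v uv.
  by exists a; rewrite // aE finset.set21.
exists K; last by rewrite /copy_vertices eF.
rewrite finset.inE; apply/andP; split.
  rewrite card_imset; last exact: can_inj e'K.
  rewrite -(card_imset _ val_inj) -G_edges -(card_imset _ (imset_inj f_inj)).
  apply/eqP; congr #|pred_of_set _|; apply/setP => y; apply/imsetP/idP.
    by case=> a; rewrite finset.inE => ? ->.
  case/imsetP => x /imsetP[[u v]]; rewrite finset.inE /= => uv -> ->.
  have [a aF aE] := edgeF u v uv.
  by exists a; rewrite // imsetU1 imset_set1.
rewrite eF; apply/asboolP.
have fcov u : f u \in covered F by rewrite covF -fA imset_f.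
(* [g] is [f] with values in the vertices of the edge subgraph; its inverse is the required
   isomorphism onto [G]. *)
pose g u : edge_vertex F := exist (fun x => x \in covered F) (f u) (fcov u).
have g_inj : injective g by move=> u v /(congr1 val) /f_inj.
have [g' gK g'K] : bijective g.
  apply: inj_card_bij g_inj _; rewrite card_sig -AG -covF.
  by apply/eq_leq/eq_card.
exists g'; split; first by exists g.
move=> x y; rewrite -[x in RHS]g'K -[y in RHS]g'K.
move: (g' x) (g' y) => u v {x y}; apply/idP/exists_inP => [uv|[a aF /eqP]].
  by have [a aF aE] := edgeF u v uv; exists a; rewrite //= aE.
(* An edge joining [f u] and [f v] comes from some adjacent pair; by injectivity of [f] this is the
   pair [u], [v], possibly in the other order. *)
have [u' [v' [uv' ->]]] := Fedge a aF => /= E.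
have {}E : [set u'; v'] = [set u; v].
  by apply: (imset_inj f_inj); rewrite !imsetU1 !imset_set1.
have := finset.set21 u v; have := finset.set22 u v; rewrite -E !finset.inE.
have uDv : u != v.
  apply/eqP => uv; have : #|[set u'; v']| = 1%N by rewrite E uv finset.setUid cards1.
  by rewrite cards2; case: eqVneq uv' => // ->; rewrite adj_irr.
by case/orP=> /eqP vE; case/orP=> /eqP uE; move: uDv uv';
  rewrite uE vE ?eqxx // adj_sym.
Qed.

(** By [copy_on], every set of |G| vertices is the vertex set of some copy. *)
Lemma card_copy_family_ge : ('C(n, #|G|) <= #|copy_family|)%N.
Proof.
have := cards_draws [set: 'I_n] #|G|; rewrite cardsT card_ord => <-.
apply: leq_trans (leq_imset_card copy_vertices _).
apply/subset_leq_card/fintype.subsetP => A; rewrite finset.inE => /andP[_ /eqP AG].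
by have [K KF <-] := copy_on A AG; apply: imset_f.
Qed.

End Copies.

(** Gives n^2 D = O(N). It follows from n(n-1) C(n-2, l-2) = l(l-1) C(n, l) and n <= 2(n-1). *)
Lemma sqr_mul_bin_le (n l : nat) : (2 <= l)%N -> (l <= n)%N ->
  (n ^ 2 * 'C(n - 2, l - 2) <= 2 * l ^ 2 * 'C(n, l))%N.
Proof.
case: l n => [|[|l]] // [|[|n]] // _ _; rewrite !subSS !subn0.
have e1 := mul_bin_diag n.+2 l.+1; have e2 := mul_bin_diag n.+1 l.
rewrite /= in e1 e2.
have : (n.+2 * n.+1 * 'C(n, l) = l.+2 * l.+1 * 'C(n.+2, l.+2))%N.
  by rewrite -mulnA e2 mulnCA e1; ring.
move: 'C(n, l) 'C(n.+2, l.+2) => a b E.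
rewrite (@leq_trans (2 * (n.+2 * n.+1 * a))) //; first by nia.
by rewrite E; nia.
Qed.

(** Gives D2 = O(D / n). It follows from (n-2) C(n-3, l-3) = (l-2) C(n-2, l-2) and n <= 3(n-2). *)
Lemma mul_bin3_le (n l : nat) : (3 <= l)%N -> (l <= n)%N ->
  (n * 'C(n - 3, l - 3) <= 3 * l * 'C(n - 2, l - 2))%N.
Proof.
case: l n => [|[|[|l]]] // [|[|[|n]]] // _ _; rewrite !subSS !subn0.
have := mul_bin_diag n.+1 l; rewrite /=.
move: 'C(n, l) 'C(n.+1, l.+1) => a b E.
rewrite (@leq_trans (3 * (n.+1 * a))) //; first by nia.
by rewrite E; nia.
Qed.

(** * The law of the random edge set *)

Section Law.
Context {d : measure_display} {T : measurableType d} {R : realType}.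
Context {P : probability T R} {I : finType}.
Variables (p : R) (X : I -> {RV P >-> R}).
Hypothesis X_ber : forall i, bernoulli_RV p (X i).
Hypothesis X_ind : independent_RVs X.

Definition success_set (t : T) : {set I} := [set i | X i t == 1].

Local Notation fiber A := [set t | success_set t = A]%classic.

(** Absence is encoded as X_i <> 1 rather than X_i = 0: other values are possible on a null set, and
    the fibers of [success_set] must cover the whole space. *)
Let B (A : {set I}) i : set R := if i \in A then [set 1]%classic else (~` [set 1])%classic.

Let fiberE A : fiber A = [set t | forall i, i \in [set: I]%SET -> B A i (X i t)]%classic.
Proof.
apply/seteqP; split => t /= h.
  move=> i _; rewrite /B -h finset.inE; case: eqP => [->|] //.
apply/setP => i; rewrite finset.inE; have := h i; rewrite finset.inE => /(_ isT).
by rewrite /B; case: (i \in A) => /= /eqP // /negbTE.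
Qed.

Let B_meas A i : measurable (B A i).
Proof. by rewrite /B; case: ifP => _; [|apply: measurableC]; exact: measurable_set1. Qed.

Let X_meas i (Y : set R) : measurable Y -> measurable [set t | Y (X i t)]%classic.
Proof.
by move=> mY; rewrite -[X in measurable X]setTI; exact: (measurable_funP (X i)).
Qed.

Lemma measurable_fiber A : measurable (fiber A).
Proof.
rewrite fiberE [X in measurable X](_ : _ =
  (\bigcap_(i in [set: I]) [set t | B A i (X i t)])%classic).
  apply: fin_bigcap_measurable; first exact: finite_finset.
  by move=> i _; exact: X_meas.
by apply/seteqP; split => t /= h i _; apply: h; rewrite ?finset.inE.
Qed.

Lemma prob_fiber A : P (fiber A) = (cube_weight p A)%:E.
Proof.
rewrite fiberE X_ind; last by move=> i _; exact: B_meas.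
rewrite /cube_weight -prodEFin; apply: eq_big => [i|i _]; first by rewrite finset.inE.
have [h1 h0] := X_ber i; rewrite /B; case: (i \in A) => //.
have m1 : measurable [set t | X i t = 1]%classic.
  by apply: (X_meas i [set 1]%classic); exact: measurable_set1.
have -> : ([set t | (~` [set 1]) (X i t)] = ~` [set t | X i t = 1])%classic by [].
by rewrite probability_setC // h1.
Qed.

Lemma success_set_sumE (f : {set I} -> R) t :
  f (success_set t) = \sum_A f A * \1_(fiber A) t.
Proof.
rewrite (bigD1 (success_set t)) //= indicE mem_set // mulr1 big1 ?addr0 // => A At.
by rewrite indicE memNset ?mulr0 // => /= E; rewrite E eqxx in At.
Qed.

Lemma measurable_success_set (f : {set I} -> R) :
  measurable_fun setT (fun t => f (success_set t)).
Proof.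
rewrite (_ : (fun t => _) = (fun t => \sum_A f A * \1_(fiber A) t)).
  apply: measurable_sum => A; apply: measurable_funM => //.
  by apply: measurable_indic; exact: measurable_fiber.
by apply/funext => t; exact: success_set_sumE.
Qed.

Lemma integral_success_set (f : {set I} -> R) : (forall A, 0 <= f A) ->
  (\int[P]_t (f (success_set t))%:E = (cube_mean p f)%:E)%E.
Proof.
move=> f0; under eq_integral do rewrite success_set_sumE -sumEFin.
have mfib A : measurable_fun setT (fun t => (\1_(fiber A) t : R)%:E).
  by apply/measurable_EFinP; apply: measurable_indic; exact: measurable_fiber.
rewrite ge0_integral_sum //.
- rewrite /cube_mean -sumEFin; apply: eq_bigr => A _.
  under eq_integral do rewrite EFinM.
  rewrite ge0_integralZl_EFin //.
  rewrite integral_indic ?setIT //; last exact: measurable_fiber.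
  by rewrite [X in (_ * X)%E](prob_fiber A) -EFinM mulrC.
- move=> A; under eq_fun do rewrite EFinM.
  by apply: emeasurable_funM.
- by move=> A t _; rewrite lee_fin mulr_ge0.
Qed.

(** [bernoulli_RV] only prescribes the probabilities of the values 1 and 0. They add up to 1, so
    other values have probability zero, and there are finitely many indices. *)
Lemma ae_success_set : {ae P, forall t i, X i t = (i \in success_set t)%:R}.
Proof.
suff: \forall t \ae P, forall i, X i t = 1 \/ X i t = 0.
  apply: filterS => t Xt i; rewrite finset.inE.
  by case: (Xt i) => ->; rewrite ?eqxx // eq_sym oner_eq0.
apply: filter_forall => i.
have m1 : measurable [set t | X i t = 1]%classic.
  by apply: (X_meas i [set 1]%classic); exact: measurable_set1.
have m0 : measurable [set t | X i t = 0]%classic.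
  by apply: (X_meas i [set 0]%classic); exact: measurable_set1.
exists (~` ([set t | X i t = 1] `|` [set t | X i t = 0]))%classic; split => //.
- by apply: measurableC; apply: measurableU.
- have [h1 h0] := X_ber i.
  rewrite probability_setC ?measureU //; last 2 first.
    by apply/seteqP; split => // t [/= ->] /eqP; rewrite oner_eq0.
    by apply: measurableU.
  rewrite [X in (_ - (X + _))%E]h1 [X in (_ - (_ + X))%E]h0.
  by rewrite -EFinD (addrC p) subrK subrr.
Qed.

Variables (Fam : {set {set I}}) (W : T -> R).
Hypothesis WE : forall t, W t = \sum_(K in Fam) \prod_(i in K) X i t.

Let W_meas : measurable_fun setT W.
Proof.
rewrite (_ : W = fun t => \sum_K if K \in Fam then
    \prod_i (if i \in K then X i t else 1) else 0).
  apply: measurable_sum => K; case: (K \in Fam); last exact: measurable_cst.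
  apply: measurable_prod => i _; case: (i \in K); last exact: measurable_cst.
  exact: measurable_funP.
apply/funext => t; rewrite WE big_mkcond; apply: eq_bigr => K _.
by case: (K \in Fam); rewrite // big_mkcond.
Qed.

Let W_ae : {ae P, forall t, W t = subset_count Fam (success_set t)}.
Proof.
apply: filterS ae_success_set => t Xt; rewrite WE; apply: eq_bigr => K _.
have [KS|/subsetPn[i iK iS]] := boolP (K \subset success_set t).
  by rewrite big1 // => i iK; rewrite Xt (fintype.subsetP KS).
by rewrite (bigD1 i) //= Xt (negbTE iS) mul0r.
Qed.

Lemma expectation_count : 'E_P[W]%E = (cube_mean p (subset_count Fam))%:E.
Proof.
rewrite unlock -integral_success_set; last by move=> S; exact: subset_count_ge0.
apply: ae_eq_integral => //.
- exact/measurable_EFinP.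
- by apply/measurable_EFinP; exact: measurable_success_set.
- by apply: filterS W_ae => t Wt _; rewrite Wt.
Qed.

Lemma prob_count_ge (a : R) :
  P [set t | a <= W t]%classic =
  (cube_mean p (fun S => (a <= subset_count Fam S)%R%:R))%:E.
Proof.
have mE : measurable [set t | a <= W t]%classic.
  have : measurable_fun setT (fun t => a <= W t) by exact: measurable_fun_ler.
  by move=> /(_ measurableT [set true]%classic Logic.I); rewrite setTI preimage_true.
rewrite -integral_success_set // -[in LHS](setIT [set t | _]%classic) -integral_indic //.
apply: ae_eq_integral => //.
- by apply/measurable_EFinP; exact: measurable_indic.
- apply/measurable_EFinP.
  exact: (measurable_success_set (fun S => (a <= subset_count Fam S)%R%:R)).
- apply: filterS W_ae => t Wt _; rewrite indicE -Wt; congr ((nat_of_bool _)%:R%:E).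
  by apply/idP/idP => [/set_mem|/mem_set].
Qed.

End Law.

(** * Rewriting the exponent and choosing the constants *)

Lemma tail_exponentE (R : realType) (l k : nat) (c eps p n : R) :
  (0 < l)%N -> (0 < k)%N -> 0 < eps -> 0 < n -> 0 < p -> p < 1 ->
  c * eps ^+ 2 * n ^+ (2 * l) * p ^+ (2 * k) /
    (n ^+ (2 * l - 2) * p ^+ (2 * k - 1) * (1 - p) +
     1 * eps * n ^+ (2 * l - 2) * p ^ (1 - k%:Z) * (1 - p)^-1) =
  c * n ^+ 2 * eps ^+ 2 * (p ^+ k) ^+ 2 /
    (p ^+ k * p ^+ k.-1 * (1 - p) + eps / (p ^+ k.-1 * (1 - p))).
Proof.
move=> l0 k0 e0 n0 p0 p1.
have -> : n ^+ (2 * l) = n ^+ (2 * l - 2) * n ^+ 2.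
  by rewrite -exprD; congr (_ ^+ _); lia.
have -> : p ^+ (2 * k - 1) = p ^+ k * p ^+ k.-1.
  by rewrite -exprD; congr (_ ^+ _); lia.
have -> : p ^ (1 - k%:Z) = (p ^+ k.-1)^-1.
  have -> : 1 - k%:Z = - (k.-1)%:Z by lia.
  by rewrite -exprnN.
rewrite (mulnC 2 k) exprM.
have : 0 < n ^+ (2 * l - 2) by rewrite exprn_gt0.
have : 0 < p ^+ k by rewrite exprn_gt0.
have : 0 < p ^+ k.-1 by rewrite exprn_gt0.
have : 0 < 1 - p by rewrite subr_gt0.
move: (1 - p) (p ^+ k.-1) (p ^+ k) (n ^+ (2 * l - 2)) => q v u M q0 v0 u0 M0.
have w0 : 0 < u * v * q + eps / (v * q) by rewrite addr_gt0 ?divr_gt0 ?mulr_gt0.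
(* The common factor M = n^(2l-2) comes out of the denominator and cancels against the numerator. *)
rewrite (_ : M * (u * v) * q + 1 * eps * M / v / q =
  M * (u * v * q + eps / (v * q))); last first.
  by field; rewrite !lt0r_neq0.
move: (u * v * q + _) w0 => w w0.
by field; rewrite !lt0r_neq0.
Qed.

Theorem theorem1p3 (R : realType) (l k : nat) (hl : (3 <= l)%N) (hk : (2 <= k)%N) :
  exists c1 c2 : R, 0 < c1 /\ 0 < c2 /\
  forall (G : sgraph) (hGl : #|G| = l) (hGk : #|edge_set G| = k)
    (hG : no_isolated G)
    (n : nat) (hn : (l <= n)%N) (p : R) (hp0 : 0 < p) (hp1 : p < 1)
    (e : 'I_('C(n, 2)) -> Kn_edge n) (he : bijective e)
    (d : measure_display) (T : measurableType d) (P : probability T R)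
    (X : 'I_('C(n, 2)) -> {RV P >-> R})
    (hXber : forall i, bernoulli_RV p (X i))
    (hXind : independent_RVs X)
    (eps : R) (heps : 0 < eps),
  let W : T -> R := copies G k e (fun i => X i : T -> R) in
  (P [set t | (eps%:E * 'E_P[W] <= (W t)%:E - 'E_P[W])%E]%classic <=
   (expR (- (c1 * eps ^+ 2 * n%:R ^+ (2 * l) * p ^+ (2 * k) /
      (n%:R ^+ (2 * l - 2) * p ^+ (2 * k - 1) * (1 - p) +
       c2 * eps * n%:R ^+ (2 * l - 2) * p ^ (1 - k%:Z) * (1 - p)^-1))))%:E)%E.
Proof.
(* [C0] bounds the number of copies on a given set of l vertices; it is kept behind an equation so
   that the double power is never unfolded. *)
have [C0 C0E] : exists C0 : nat, C0 = (2 ^ (2 ^ l))%N by eexists.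
(* This is the largest constant that the last hypothesis of [count_tail] allows by these estimates:
   2 l^2 comes from [sqr_mul_bin_le], r = 3 l from [mul_bin3_le], and [C0] from [D]. *)
pose c : R := ((2 * l ^ 2) * (16 * k * (1 + k * (3 * l))) * C0)%:R^-1.
have C0_gt0 : (0 < C0)%N by rewrite C0E expn_gt0.
have M_gt0 : (0 < 2 * l ^ 2 * (16 * k * (1 + k * (3 * l))) * C0)%N.
  by rewrite !muln_gt0 C0_gt0 /= (ltnW hk) (ltnW (ltnW hl)).
have c_gt0 : 0 < c by rewrite invr_gt0 ltr0n.
exists c, 1; do 2 split => //.
move=> G hGl hGk hG n hn p hp0 hp1 e he d T P X hXber hXind eps heps.
cbv zeta; set W := copies _ _ _ _.
pose Fam := copy_family n G k e.
have Fam_card K : K \in Fam -> #|K| = k by rewrite finset.inE => /andP[/eqP].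
have WE t : W t = \sum_(K in Fam) \prod_(i in K) X i t.
  by apply: eq_bigl => K; rewrite finset.inE.
pose D : nat := C0 * 'C(n - 2, l - 2).
pose D2 : nat := C0 * 'C(n - 3, l - 3).
have Fam_edge i : (#|[set K in Fam | i \in K]|%:R : R) <= D%:R.
  rewrite ler_nat; have /eqP c2 := valP (e i).
  have := card_copies_through n G k e he (val (e i)).
  rewrite hGl c2 -C0E => /(_ (ltnW hl)); apply: leq_trans.
  apply/subset_leq_card/fintype.subsetP => K; rewrite !finset.inE => /andP[-> iK].
  exact: edge_sub_copy_vertices.
have Fam_pair i j : i != j ->
    (#|[set K in Fam | (i \in K) && (j \in K)]|%:R : R) <= D2%:R.
  move=> ij; rewrite ler_nat.
  have /eqP ci := valP (e i); have /eqP cj := valP (e j).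
  (* Two distinct edges span at least three vertices: some endpoint [x] of the second lies off the
     first, so a copy through both contains the three vertices [x |: val (e i)]. *)
  have [x xj xi] : exists2 x, x \in val (e j) & x \notin val (e i).
    apply/subsetPn; apply/negP => ji; move/eqP: ij; apply.
    apply: (bij_inj he); apply/val_inj/esym/eqP.
    by rewrite eqEcard ji /= ci cj.
  have := card_copies_through n G k e he (x |: val (e i)).
  rewrite cardsU1 xi ci hGl -C0E => /(_ hl); apply: leq_trans.
  apply/subset_leq_card/fintype.subsetP => K.
  rewrite !finset.inE => /andP[-> /andP[iK jK]] /=.
  rewrite finset.subUset finset.sub1set.
  rewrite (fintype.subsetP (edge_sub_copy_vertices _ _ _ _ jK)) //=.
  exact: edge_sub_copy_vertices.
have FamN : ('C(n, l) <= #|Fam|)%N.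
  by rewrite -hGl; apply: card_copy_family_ge.
have n_gt0 : (0 < n)%N by apply: leq_trans hn; apply: leq_trans hl.
rewrite tail_exponentE ?ltr0n //; last 2 first.
- exact: ltnW (ltnW hl).
- exact: ltnW hk.
have EW : 'E_P[W]%E = (#|Fam|%:R * p ^+ k)%:E.
  by rewrite (expectation_count p X hXber hXind Fam W WE)
    (cube_mean_count Fam p k Fam_card).
rewrite EW (_ : [set t | _]%classic =
  [set t | (1 + eps) * (#|Fam|%:R * p ^+ k) <= W t]%classic); last first.
  apply/funext => t; rewrite /mkset -EFinM -EFinB lee_fin; apply/propext.
  by rewrite lerBrDl mulrDl mul1r.
rewrite (prob_count_ge p X hXber hXind Fam W WE) lee_fin.
apply: (count_tail Fam p D%:R D2%:R k hp0 hp1 _ Fam_card Fam_edge _ _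
  Fam_pair (3 * l)%:R) => //.
- exact: ltnW hk.
- by rewrite ltr0n muln_gt0 C0_gt0 bin_gt0 leq_sub2r.
- by rewrite ltr0n.
- by apply: leq_trans FamN; rewrite bin_gt0.
- rewrite ler_pdivlMr ?ltr0n // -!natrM ler_nat /D2 /D -mulnA (mulnC _ n).
  by rewrite [leqRHS]mulnCA leq_mul2l mul_bin3_le ?orbT.
- rewrite /c lef_pV2 ?posrE ?ltr0n ?M_gt0 // (ler_nat R 2) -!mulnA leq_pmulr //.
  by rewrite !muln_gt0 C0_gt0 /= (ltnW hk) (ltnW (ltnW hl)).
(* By the choice of [c], all factors except 2 l^2 cancel, and the remaining inequality is n^2 C(n-2,
   l-2) <= 2 l^2 N. *)
rewrite (_ : _ * D%:R = (n ^ 2 * 'C(n - 2, l - 2))%:R / (2 * l ^ 2)%:R).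
  rewrite ler_pdivrMr ?ltr0n; last by rewrite !muln_gt0 /= (ltnW (ltnW hl)).
  rewrite -natrM ler_nat; apply: leq_trans (sqr_mul_bin_le _ _ (ltnW hl) hn) _.
  by rewrite mulnC leq_mul2r FamN orbT.
rewrite /c /D !natrM !natrD !natrM; field.
by rewrite -!natrM nat1r !pnatr_eq0 -!lt0n C0_gt0 (ltnW hk) (ltnW (ltnW hl)).
Qed.
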